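(* Let $a,b,c$ be real numbers such that $$1-a-b-c>0,\quad 1-a+b+c>0,\quad 1+a-b+c>0,\quad 1+a+b-c>0.$$ Consider the recurrence equation $$x_{i,j}=ax_{i-1,j}+bx_{i,j-1}+cx_{i-1,j-1}+v_{i,j}\qquad\text{for all positive integers } i,j,$$ where $v_{i,j}$ ($i>0$, $j>0$) are known real numbers, $x_{0,0}$, $x_{i,0}$ ($i>0$) and $x_{0,j}$ ($j>0$) are preset real numbers (initial/boundary conditions), and $x_{i,j}$ ($i>0$, $j>0$) are unknown. Then the solution is given explicitly, for all positive integers $i,j$, by $$x_{i,j}=\psi_{i,j}x_{0,0}+\sum_{k=0}^{i-1}\psi_{k,j}\,(x_{i-k,0}-a\,x_{i-k-1,0})+\sum_{l=0}^{j-1}\psi_{i,l}\,(x_{0,j-l}-b\,x_{0,j-l-1})+\sum_{k=0}^{i-1}\sum_{l=0}^{j-1}\psi_{k,l}\,v_{i-k,j-l},$$ where, for integers $k,l\ge0$, $$\psi_{k,l}=\sum_{m=0}^{\min(k,l)}\binom{k}{m}\binom{l}{m}a^{k-m}b^{l-m}(ab+c)^m.$$ If, in addition, the sequences $(x_{i,0})_i$ and $(x_{0,j})_j$ and the array $(v_{i,j})_{i,j}$ are bounded, then the solution $x$ is also bounded.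
   Context: The convention $0^0=1$ is used. *)

(* Defs.v *)
From mathcomp Require Import all_boot all_order all_algebra.
From mathcomp Require Import all_classical all_reals all_analysis.

Set Implicit Arguments.
Unset Strict Implicit.
Unset Printing Implicit Defensive.

Import Order.TTheory GRing.Theory Num.Theory numFieldNormedType.Exports.
Local Open Scope ring_scope.

(* Since [x ^+ 0 = 1] for every [x], the convention 0^0 = 1 is built in. *)
Definition psi (R : realType) (a b c : R) (k l : nat) : R :=
  \sum_(0 <= m < (minn k l).+1)
     ('C(k, m) * 'C(l, m))%:R * a ^+ (k - m) * b ^+ (l - m)
       * (a * b + c) ^+ m.

(* The boundary data are the values [x i 0] and [x 0 j]; the values of [v]
   on the axes are never used. *)
Definition recurrence (R : realType) (a b c : R) (v x : nat -> nat -> R) :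
    Prop :=
  forall i j : nat, (0 < i)%N -> (0 < j)%N ->
    x i j = a * x (i - 1)%N j + b * x i (j - 1)%N + c * x (i - 1)%N (j - 1)%N
            + v i j.

(* Only the boundary values of [x] occur: the index subtractions below are
   never truncated, because [k < i] and [l < j]. *)
Definition explicit_value (R : realType) (a b c : R) (v x : nat -> nat -> R)
    (i j : nat) : R :=
  psi a b c i j * x 0%N 0%N
  + \sum_(0 <= k < i)
       psi a b c k j * (x (i - k)%N 0%N - a * x (i - k - 1)%N 0%N)
  + \sum_(0 <= l < j)
       psi a b c i l * (x 0%N (j - l)%N - b * x 0%N (j - l - 1)%N)
  + \sum_(0 <= k < i) \sum_(0 <= l < j)
       psi a b c k l * v (i - k)%N (j - l)%N.

(* Main.v *)
(* Pascal's rule gives [psi] the homogeneous recurrence, so the explicit formula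
   is a discrete convolution with the fundamental solution; it also reproduces
   the boundary values by telescoping.

   For boundedness, put s_{k,l} = psi_{k+1,l} - b psi_{k+1,l-1} and d = ab + c.
   Then s_{k+1,l+1} = a s_{k,l+1} + d psi_{k+1,l} and
   psi_{k+1,l+1} = s_{k,l+1} + b psi_{k+1,l}, a first-order system with matrix
   [[a, d], [1, b]] of determinant -c. The four hypotheses say exactly that this
   matrix contracts some diagonal quadratic form p s^2 + x^2. As s only moves in
   the direction of k and psi only in the direction of l, the energy summed over
   the antidiagonal k + l = n decays geometrically in n, hence so does psi. *)
Require Import Defs.
From mathcomp Require Import all_boot all_order all_algebra.
From mathcomp Require Import all_classical all_reals all_analysis.
From mathcomp Require Import ring lra.
Import Order.TTheory GRing.Theory Num.Theory numFieldNormedType.Exports.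
Local Open Scope classical_set_scope.
Local Open Scope ring_scope.

(** * The kernel [psi]: symmetry, values on the axes, homogeneous recurrence *)

(** Terms with [m > min(k, l)] vanish with a binomial coefficient, so neighbouring values of [psi]
    can be compared on a common range. *)
Lemma psi_widen (R : realType) (a b c : R) (k l N : nat) :
  (minn k l < N)%N ->
  psi a b c k l =
  \sum_(0 <= m < N) ('C(k, m)%:R * a ^+ (k - m)) * ('C(l, m)%:R * b ^+ (l - m))
                      * (a * b + c) ^+ m.
Proof.
move=> hN; rewrite (big_cat_nat (n := (minn k l).+1)) //=.
rewrite [X in _ + X]big_nat_cond [X in _ + X]big1 ?addr0.
  by apply: eq_bigr => m _; rewrite natrM; ring.
move=> m /andP[/andP[hm _] _].
by move: hm; rewrite gtn_min => /orP[] /bin_small ->; rewrite !(mul0r, mulr0).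
Qed.

Lemma psi0l (R : realType) (a b c : R) (l : nat) : psi a b c 0 l = b ^+ l.
Proof. by rewrite /psi min0n big_nat1 !bin0 !subn0 !expr0 muln1 !mulr1 mul1r. Qed.

Lemma psi_sym (R : realType) (a b c : R) (k l : nat) :
  psi a b c k l = psi b a c l k.
Proof.
rewrite /psi minnC; apply: eq_bigr => m _.
by rewrite mulnC (mulrC a b); ring.
Qed.

Lemma psik0 (R : realType) (a b c : R) (k : nat) : psi a b c k 0 = a ^+ k.
Proof. by rewrite psi_sym psi0l. Qed.

Lemma binX_rec (R : comNzRingType) (a : R) (k m : nat) :
  'C(k.+1, m.+1)%:R * a ^+ (k.+1 - m.+1) =
  a * ('C(k, m.+1)%:R * a ^+ (k - m.+1)) + 'C(k, m)%:R * a ^+ (k - m).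
Proof.
rewrite binS natrD mulrDl subSS; congr (_ + _).
(* For [k <= m] the subtraction [k - m.+1] is truncated, but ['C(k, m.+1)] is then zero. *)
have [km|mk] := leqP k m; first by rewrite bin_small //; ring.
by rewrite mulrCA -exprS -subSn // subSS.
Qed.

(** Subtracting [a * psi k l] cancels the term [m = 0]; Pascal's rule lowers [m] in the [k]-factor
    alone and leaves the [l]-factor free for a second use. *)
Lemma psi_shiftl (R : realType) (a b c : R) (k l N : nat) :
  (k <= N)%N ->
  psi a b c k.+1 l - a * psi a b c k l =
  \sum_(0 <= m < N.+1) ('C(k, m)%:R * a ^+ (k - m))
     * ('C(l, m.+1)%:R * b ^+ (l - m.+1)) * (a * b + c) ^+ m.+1.
Proof.
move=> hN.
rewrite (@psi_widen _ _ _ _ k.+1 l N.+2) ?(@psi_widen _ _ _ _ k l N.+2);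
  try by rewrite gtn_min ltnS ?ltnS (leqW hN, hN).
rewrite big_nat_recl // [in X in _ - X]big_nat_recl // mulrDr mulr_sumr.
rewrite !bin0 !subn0 exprS.
rewrite opprD addrACA -sumrB [X in X + _](_ : _ = 0) ?add0r; last by ring.
by apply: eq_bigr => m _; rewrite binX_rec; ring.
Qed.

Lemma psiSS (R : realType) (a b c : R) (k l : nat) :
  psi a b c k.+1 l.+1 =
  a * psi a b c k l.+1 + b * psi a b c k.+1 l + c * psi a b c k l.
Proof.
(* The recurrence factored: the [a]-difference in [k] obeys a first-order relation in [l], which is
   Pascal's rule on the [l]-factor. *)
suff: psi a b c k.+1 l.+1 - a * psi a b c k l.+1 =
      b * (psi a b c k.+1 l - a * psi a b c k l) + (a * b + c) * psi a b c k l.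
  by move=> /eqP; rewrite subr_eq => /eqP ->; ring.
rewrite !(@psi_shiftl _ _ _ _ k _ k) // (@psi_widen _ _ _ _ k l k.+1).
  rewrite !mulr_sumr -big_split; apply: eq_bigr => m _ /=.
  by rewrite binX_rec [_ ^+ m.+1]exprS; ring.
by rewrite gtn_min ltnSn.
Qed.

(** * Convolutions with [psi] and the explicit formula *)

Lemma psi_conv0 (R : realType) (a b c : R) (y : nat -> R) (j : nat) :
  \sum_(0 <= l < j.+1) psi a b c 0 l * y (j.+1 - l)%N =
  b * (\sum_(0 <= l < j) psi a b c 0 l * y (j - l)%N) + y j.+1.
Proof.
rewrite big_nat_recl // psi0l subn0 mul1r addrC mulr_sumr; congr (_ + _).
by apply: eq_bigr => l _; rewrite subSS !psi0l exprS mulrA.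
Qed.

(** The term [l = 0] contributes only to the [a]-part because [psi k 0 = a ^+ k]; the others follow
    [psiSS]. *)
Lemma psi_convS (R : realType) (a b c : R) (y : nat -> R) (k j : nat) :
  \sum_(0 <= l < j.+1) psi a b c k.+1 l * y (j.+1 - l)%N =
  a * (\sum_(0 <= l < j.+1) psi a b c k l * y (j.+1 - l)%N)
  + b * (\sum_(0 <= l < j) psi a b c k.+1 l * y (j - l)%N)
  + c * (\sum_(0 <= l < j) psi a b c k l * y (j - l)%N).
Proof.
rewrite big_nat_recl // [in X in a * X]big_nat_recl // mulrDr !mulr_sumr.
rewrite -!addrA -!big_split /= !psik0 exprS -mulrA; congr (_ + _).
by apply: eq_bigr => l _; rewrite subSS psiSS /=; ring.
Qed.

Lemma psi_conv_boundary (R : realType) (a b c : R) (y : nat -> R) (j : nat) :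
  psi a b c 0 j * y 0%N
  + \sum_(0 <= l < j) psi a b c 0 l * (y (j - l)%N - b * y (j - l - 1)%N)
  = y j.
Proof.
elim: j => [|j IH]; first by rewrite big_nil psi0l addr0 mul1r.
rewrite (psi_conv0 _ _ _ _ (fun n => y n - b * y (n - 1)%N)) subn1 /=.
by move: IH; rewrite !psi0l exprS => IH; rewrite -[y j]IH; ring.
Qed.

Lemma explicit_value0j (R : realType) (a b c : R) (v x : nat -> nat -> R) j :
  explicit_value a b c v x 0 j = x 0%N j.
Proof.
by rewrite /explicit_value !big_nil !addr0 (psi_conv_boundary _ _ _ _ (x 0%N)).
Qed.

Lemma explicit_valuei0 (R : realType) (a b c : R) (v x : nat -> nat -> R) i :
  explicit_value a b c v x i 0 = x i 0%N.
Proof.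
rewrite /explicit_value !big_nil addr0.
rewrite [X in _ + X]big1 => [|k _]; last by rewrite big_nil.
rewrite addr0 -[RHS](psi_conv_boundary _ b a c (fun n => x n 0%N)) psi_sym.
by congr (_ + _); apply: eq_bigr => k _; rewrite psi_sym.
Qed.

Lemma explicit_value_rec (R : realType) (a b c : R) (v x : nat -> nat -> R)
    i j :
  explicit_value a b c v x i.+1 j.+1 =
  a * explicit_value a b c v x i j.+1 + b * explicit_value a b c v x i.+1 j
  + c * explicit_value a b c v x i j + v i.+1 j.+1.
Proof.
rewrite /explicit_value psiSS.
rewrite (psi_convS _ _ _ _ (fun n => x 0%N n - b * x 0%N (n - 1)%N)).
pose u n := x n 0%N - a * x (n - 1)%N 0%N.
(* By symmetry the sum along the other axis is the same convolution with [a] and [b] exchanged. *)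
have U k n : \sum_(0 <= k0 < n) psi a b c k0 k * (x (n - k0)%N 0%N
      - a * x (n - k0 - 1)%N 0%N)
    = \sum_(0 <= l < n) psi b a c k l * u (n - l)%N.
  by apply: eq_bigr => m _; rewrite psi_sym.
rewrite !U (psi_convS _ b a c u).
have -> : \sum_(0 <= k < i.+1) \sum_(0 <= l < j.+1)
             psi a b c k l * v (i.+1 - k)%N (j.+1 - l)%N =
  a * (\sum_(0 <= k < i) \sum_(0 <= l < j.+1)
             psi a b c k l * v (i - k)%N (j.+1 - l)%N)
  + b * (\sum_(0 <= k < i.+1) \sum_(0 <= l < j)
             psi a b c k l * v (i.+1 - k)%N (j - l)%N)
  + c * (\sum_(0 <= k < i) \sum_(0 <= l < j)
             psi a b c k l * v (i - k)%N (j - l)%N) + v i.+1 j.+1.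
  (* The row [k = 0] is split off: it alone produces the source term [v i.+1 j.+1]. *)
  rewrite big_nat_recl // subn0 psi_conv0.
  under eq_bigr => k _ do rewrite subSS psi_convS.
  rewrite !big_split /= -!mulr_sumr [in X in _ = _ + b * X + _ + _]big_nat_recl //.
  rewrite subn0.
  under [in X in _ = _ + b * (_ + X) + _ + _]eq_bigr => k _ do rewrite subSS.
  ring.
ring.
Qed.

Lemma recurrence_explicit (R : realType) (a b c : R) (v x : nat -> nat -> R) :
  recurrence a b c v x ->
  forall i j, x i j = explicit_value a b c v x i j.
Proof.
move=> hx; elim=> [|i IHi]; first by move=> j; rewrite explicit_value0j.
elim=> [|j IHj]; first by rewrite explicit_valuei0.
by rewrite explicit_value_rec -!IHi -IHj hx // !subn1.
Qed.

Lemma explicit_recurrence (R : realType) (a b c : R) (v x : nat -> nat -> R) :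
  (forall i j : nat, (0 < i)%N -> (0 < j)%N ->
     x i j = explicit_value a b c v x i j) ->
  recurrence a b c v x.
Proof.
move=> hx.
(* The formula reproduces the axes too, so its recurrence transfers to [x] even next to the
   boundary. *)
have hE i j : x i j = explicit_value a b c v x i j.
  case: i => [|i]; first by rewrite explicit_value0j.
  case: j => [|j]; first by rewrite explicit_valuei0.
  exact: hx.
by case=> [|i] // [|j] // _ _; rewrite !subn1 /= !hE explicit_value_rec.
Qed.

(** * A contracted diagonal quadratic form *)

(* [p] balances the off-diagonal entries of the matrix of
   [(s, x) |-> (a s + d x, s + b x)]: for [d != 0] the matrix becomes symmetric
   up to the sign of a row, so its norm is its spectral radius. *)
Lemma diagonal_stability (R : realType) (a b c : R)
    (h1 : 0 < 1 - a - b - c) (h2 : 0 < 1 - a + b + c)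
    (h3 : 0 < 1 + a - b + c) (h4 : 0 < 1 + a + b - c) :
  let d := a * b + c in
  exists p : R, [/\ 0 < p, 0 < p - p * a ^+ 2 - 1 &
    (p * a * d + b) ^+ 2
      < (p - p * a ^+ 2 - 1) * (1 - p * d ^+ 2 - b ^+ 2)].
Proof.
move=> d.
(* Adding the hypotheses in pairs gives [|a| < 1] and [|b| < 1]. *)
have a2 : 0 < 1 - a ^+ 2.
  by rewrite (_ : _ - _ = (1 - a) * (1 + a)); [apply: mulr_gt0; lra|ring].
have b2 : 0 < 1 - b ^+ 2.
  by rewrite (_ : _ - _ = (1 - b) * (1 + b)); [apply: mulr_gt0; lra|ring].
case: (ltgtP d 0) => [d0|d0|d0].
- exists (- d)^-1.
  have g0 : 0 < (- d)^-1 by rewrite invr_gt0; lra.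
  have gd : (- d)^-1 * d = -1 by rewrite invrN mulNr mulVf // lt_eqF.
  (* This is the combination of [h2] and [h3] with positive weights [(1 + a) / 2] and
     [(1 - a) / 2]. *)
  have e : 0 < 1 - a ^+ 2 + d.
    rewrite /d; nra.
  split=> //.
    rewrite (_ : _ - 1 = (- d)^-1 * (1 - a ^+ 2 + d)); first exact: mulr_gt0.
    by rewrite mulrDr gd; ring.
  (* With this [p] the discriminant gap factors into the left-over positive quantities of [h2] and
     [h3]. *)
  rewrite -subr_gt0 (_ : _ - _ = (- d)^-1 * (((1 + c) - (a - b)) * ((1 + c) + (a - b)))).
    by apply: mulr_gt0 => //; apply: mulr_gt0; lra.
  rewrite /d in gd *; field; rewrite -/d; lra.
- exists d^-1.
  have g0 : 0 < d^-1 by rewrite invr_gt0.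
  have gd : d^-1 * d = 1 by rewrite mulVf // gt_eqF.
  (* Same weights, now on [h1] and [h4]; these two also factor the discriminant gap below. *)
  have e : 0 < 1 - a ^+ 2 - d.
    rewrite /d; nra.
  split=> //.
    rewrite (_ : _ - 1 = d^-1 * (1 - a ^+ 2 - d)); first exact: mulr_gt0.
    by rewrite !mulrBr gd; ring.
  rewrite -subr_gt0 (_ : _ - _ = d^-1 * (((1 - c) - (a + b)) * ((1 - c) + (a + b)))).
    by apply: mulr_gt0 => //; apply: mulr_gt0; lra.
  rewrite /d in gd *; field; rewrite -/d; lra.
(* The matrix is triangular, so a large [p] suffices; this one makes [p - p * a ^+ 2 - 1] equal to
   [(1 - b ^+ 2)^-1], and the last inequality becomes [b ^+ 2 < 1]. *)
- have q0 : 0 < 1 + (1 - b ^+ 2)^-1 by rewrite ltr_pwDl // invr_ge0 ltW.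
  have e : (1 + (1 - b ^+ 2)^-1) / (1 - a ^+ 2) * (1 - a ^+ 2)
       = 1 + (1 - b ^+ 2)^-1 by rewrite mulfVK // gt_eqF.
  have i0 : 0 < (1 - b ^+ 2)^-1 by rewrite invr_gt0.
  have f : (1 - b ^+ 2)^-1 * (1 - b ^+ 2) = 1 by rewrite mulVf // gt_eqF.
  exists ((1 + (1 - b ^+ 2)^-1) / (1 - a ^+ 2)); split.
  + exact: divr_gt0.
  + by rewrite -[X in X - _ - _]mulr1 -mulrBr e; lra.
  + rewrite d0 -[X in X - _ - _]mulr1 -mulrBr e; nra.
Qed.

(** The loss of energy in one step is the form [A s^2 - 2 B s x + G x^2], positive definite by
    [diagonal_stability]; it therefore dominates a multiple [e] of the energy, and [r = 1 - e]. *)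
Lemma quadratic_contraction (R : realType) (a b c : R)
    (h1 : 0 < 1 - a - b - c) (h2 : 0 < 1 - a + b + c)
    (h3 : 0 < 1 + a - b + c) (h4 : 0 < 1 + a + b - c) :
  exists p r : R, [/\ 0 < p, 0 <= r < 1 & forall s x : R,
    p * (a * s + (a * b + c) * x) ^+ 2 + (s + b * x) ^+ 2
      <= r * (p * s ^+ 2 + x ^+ 2)].
Proof.
have [p [p0 al dt]] := @diagonal_stability _ a b c h1 h2 h3 h4.
set d := a * b + c in dt *.
set A := p - p * a ^+ 2 - 1 in al dt.
set G := 1 - p * d ^+ 2 - b ^+ 2 in dt.
set B := p * a * d + b in dt.
have G0 : 0 < G.
  by rewrite -(pmulr_rgt0 G al); apply: le_lt_trans dt; exact: sqr_ge0.
have G1 : G <= 1 by rewrite /G; have := mulr_ge0 (ltW p0) (sqr_ge0 d); nra.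
have D0 : 0 < A + p * G by rewrite addr_gt0 // mulr_gt0.
(* Zero of the linear part in [e] of the determinant [(A - e p)(G - e) - B^2]; the remainder [e^2 p]
   is nonnegative. *)
pose e := (A * G - B ^+ 2) / (A + p * G).
have eD : e * (A + p * G) = A * G - B ^+ 2 by rewrite /e mulfVK // gt_eqF.
have e0 : 0 < e by rewrite divr_gt0 // subr_gt0.
have eG : e < G.
  rewrite -subr_gt0 -(pmulr_lgt0 _ D0) mulrBl eD.
  rewrite (_ : _ - _ = p * G ^+ 2 + B ^+ 2); last by ring.
  by rewrite ltr_wpDr ?sqr_ge0 // mulr_gt0 // exprn_gt0.
have eA : e * p < A.
  rewrite -subr_gt0 -(pmulr_lgt0 _ D0) mulrBl mulrAC eD.
  rewrite (_ : _ - _ = A ^+ 2 + p * B ^+ 2); last by ring.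
  by rewrite ltr_wpDr ?exprn_gt0 // mulr_ge0 ?sqr_ge0 ?ltW.
exists p, (1 - e); split=> //; first by apply/andP; split; lra.
move=> s x; rewrite -subr_ge0.
rewrite (_ : _ - _ = (A - e * p) * s ^+ 2 - 2 * B * s * x + (G - e) * x ^+ 2);
  last by rewrite /A /B /G; ring.
have K : B ^+ 2 <= (A - e * p) * (G - e).
  have -> : (A - e * p) * (G - e) = A * G - e * (A + p * G) + e ^+ 2 * p by ring.
  by rewrite eD; have := mulr_ge0 (sqr_ge0 e) (ltW p0); lra.
have A0 : 0 < A - e * p by lra.
rewrite -(pmulr_rge0 _ A0).
have -> : (A - e * p)
    * ((A - e * p) * s ^+ 2 - 2 * B * s * x + (G - e) * x ^+ 2)
  = ((A - e * p) * s - B * x) ^+ 2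
    + ((A - e * p) * (G - e) - B ^+ 2) * x ^+ 2 by ring.
by rewrite addr_ge0 ?sqr_ge0 // mulr_ge0 ?sqr_ge0 // subr_ge0.
Qed.

(** * Energy on antidiagonals and geometric decay of [psi] *)

(** [f k l] feeds only the cell [(k+1, l)] and [g k l] only [(k, l+1)], so each term of one
    antidiagonal is spent exactly once on the next. *)
Lemma antidiagonal_contraction (R : realType) (f g : nat -> nat -> R) (r : R) :
  (forall l, f 0%N l.+1 + g 0%N l.+1 <= r * g 0%N l) ->
  (forall k, f k.+1 0%N + g k.+1 0%N <= r * f k 0%N) ->
  (forall k l, f k.+1 l.+1 + g k.+1 l.+1 <= r * (f k l.+1 + g k.+1 l)) ->
  forall n, \sum_(0 <= k < n.+2) (f k (n.+1 - k)%N + g k (n.+1 - k)%N)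
    <= r * \sum_(0 <= k < n.+1) (f k (n - k)%N + g k (n - k)%N).
Proof.
move=> h0l hk0 hkl n.
(* Regrouping by target cell: [f k] pairs with [g k.+1], and the two ends feed the axes. *)
have -> : \sum_(0 <= k < n.+1) (f k (n - k)%N + g k (n - k)%N) =
  g 0%N n + (\sum_(0 <= k < n) (f k (n - k)%N + g k.+1 (n - k.+1)%N)
    + f n 0%N).
  rewrite !big_split /= [X in X + _]big_nat_recr //= [X in _ + X]big_nat_recl //=.
  by rewrite subnn subn0; ring.
rewrite big_nat_recl // big_nat_recr //= subSS subnn subn0 !mulrDr.
apply: lerD; first exact: h0l.
apply: lerD; last exact: hk0.
rewrite mulr_sumr; apply: ler_sum_nat => k /andP[_ kn].
rewrite subSS; have -> : (n - k = (n - k.+1).+1)%N by rewrite -subSn.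
exact: hkl.
Qed.

Lemma psi_decay (R : realType) (a b c : R)
    (h1 : 0 < 1 - a - b - c) (h2 : 0 < 1 - a + b + c)
    (h3 : 0 < 1 + a - b + c) (h4 : 0 < 1 + a + b - c) :
  exists C r : R, [/\ 0 <= C, 0 <= r < 1 &
    forall k l, `|psi a b c k l| <= C * (r ^+ k * r ^+ l)].
Proof.
have [p [r [p0 /andP[r0 r1] hq]]] := @quadratic_contraction _ a b c h1 h2 h3 h4.
(* At [l = 0] the missing value [psi k.+1 (-1)] is taken as zero, so [s k 0 = a ^+ k.+1] and the
   initial energy is [p * a ^+ 2 + 1]. *)
pose s k l := psi a b c k.+1 l - (if l is m.+1 then b * psi a b c k.+1 m else 0).
pose f k l := p * s k l ^+ 2.
pose g k l := psi a b c k l ^+ 2.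
have f0 k l : 0 <= f k l by rewrite mulr_ge0 ?sqr_ge0 ?ltW.
have g0 k l : 0 <= g k l by exact: sqr_ge0.
have S n : \sum_(0 <= k < n.+1) (f k (n - k)%N + g k (n - k)%N)
    <= (p * a ^+ 2 + 1) * r ^+ n.
  elim: n => [|n IH].
    by rewrite big_nat1 /f /g /s !psik0 expr1 expr0 subr0 expr1n mulr1.
  have -> : (p * a ^+ 2 + 1) * r ^+ n.+1 = r * ((p * a ^+ 2 + 1) * r ^+ n).
    by rewrite [r ^+ _]exprS mulrCA.
  apply: le_trans (ler_wpM2l r0 IH).
  apply: antidiagonal_contraction => [l|k|k l]; rewrite /f /g.
  (* On each axis one of the two inputs is absent and is replaced by zero. *)
  - have := hq 0 (psi a b c 0 l); congr (_ <= _); last by ring.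
    by rewrite /s psiSS !psi0l [b ^+ l.+1]exprS; ring.
  - have := hq (s k 0%N) 0; congr (_ <= _); last by ring.
    by rewrite /s !psik0 !subr0 [a ^+ k.+2]exprS; ring.
  - have := hq (s k l.+1) (psi a b c k.+1 l); congr (_ <= _).
    by rewrite /s (psiSS _ _ _ _ k.+1 l); ring.
exists (Num.sqrt (p * a ^+ 2 + 1)), (Num.sqrt r); split.
- exact: sqrtr_ge0.
- by rewrite sqrtr_ge0 -sqrtr1 ltr_sqrt.
- move=> k l; rewrite -exprD -ler_sqr ?nnegrE ?mulr_ge0 ?exprn_ge0 ?sqrtr_ge0 //.
  rewrite real_normK ?num_real // exprMn exprAC !sqr_sqrtr //; last first.
    by rewrite addr_ge0 // mulr_ge0 ?sqr_ge0 ?ltW.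
  apply: le_trans (S (k + l)%N).
  (* The square of [psi k l] is one of the nonnegative terms of the energy on its antidiagonal;
     hence the square roots in the constants. *)
  rewrite big_mkord (bigD1 (inord k)) //= inordK ?ltnS ?leq_addr // addKn.
  rewrite -addrA addrCA lerDl addr_ge0 //.
  by apply: sumr_ge0 => i _; rewrite addr_ge0.
Qed.

(** * Boundedness from geometric sums *)

Lemma sum_geometric_le (R : realType) (r : R) (n : nat) :
  0 <= r < 1 -> \sum_(0 <= k < n) r ^+ k <= (1 - r)^-1.
Proof.
move=> /andP[r0 r1].
rewrite -(ler_pM2l (_ : 0 < 1 - r)) ?subr_gt0 // divff ?subr_eq0 ?gt_eqF //.
by rewrite big_mkord -opprB mulNr -subrX1 opprB gerBl exprn_ge0.
Qed.

Lemma ler_norm_sum_geometric (R : realType) (r K : R) (F : nat -> R) (n : nat) :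
  0 <= r < 1 -> 0 <= K -> (forall k, (k < n)%N -> `|F k| <= K * r ^+ k) ->
  `|\sum_(0 <= k < n) F k| <= K * (1 - r)^-1.
Proof.
move=> hr K0 hF; apply: le_trans (ler_wpM2l K0 (sum_geometric_le _ r n hr)).
rewrite mulr_sumr; apply: le_trans (ler_norm_sum _ _ _) _.
by apply: ler_sum_nat => k /andP[_ /hF].
Qed.

Lemma explicit_value_bounded (R : realType) (a b c C r M : R)
    (v x : nat -> nat -> R) :
  0 <= C -> 0 <= r < 1 ->
  (forall k l, `|psi a b c k l| <= C * (r ^+ k * r ^+ l)) ->
  (forall i, `|x i 0%N| <= M) -> (forall j, `|x 0%N j| <= M) ->
  (forall i j, (0 < i)%N -> (0 < j)%N -> `|v i j| <= M) ->
  exists K, forall i j, `|explicit_value a b c v x i j| <= K.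
Proof.
move=> C0 hr hpsi hx0 h0x hv; have /andP[r0 r1] := hr.
have M0 : 0 <= M by apply: le_trans (hx0 0%N).
have rX n : 0 <= r ^+ n <= 1 by rewrite exprn_ge0 // exprn_ile1 // ltW.
have hu t y z : `|y| <= M -> `|z| <= M -> `|y - t * z| <= (1 + `|t|) * M.
  move=> hy hz; rewrite mulrDl mul1r; apply: le_trans (ler_normB _ _) _.
  by rewrite lerD // normrM ler_wpM2l.
have Cr k l : C * (r ^+ k * r ^+ l) <= C * r ^+ k.
  by rewrite ler_wpM2l // ler_piMr //; have /andP[] := rX k; have /andP[] := rX l.
have CrC k l : C * (r ^+ k * r ^+ l) <= C * r ^+ l.
  by rewrite [r ^+ k * _]mulrC Cr.
(* One summand per term of the formula: the axis sums use decay in one index, the double sum decay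
   in both. *)
exists (C * M + C * ((1 + `|a|) * M) * (1 - r)^-1
  + C * ((1 + `|b|) * M) * (1 - r)^-1
  + C * M * (1 - r)^-1 * (1 - r)^-1) => i j.
have N0 t : 0 <= (1 + `|t|) * M by rewrite mulr_ge0 // addr_ge0.
rewrite /explicit_value.
have norm4 (p q s t p' q' s' t' : R) : `|p| <= p' -> `|q| <= q' ->
    `|s| <= s' -> `|t| <= t' -> `|p + q + s + t| <= p' + q' + s' + t'.
  move=> hp hq hs ht; apply: le_trans (ler_normD _ _) (lerD _ ht).
  apply: le_trans (ler_normD _ _) (lerD _ hs).
  exact: le_trans (ler_normD _ _) (lerD hp hq).
apply: norm4.
- rewrite normrM ler_pM //; apply: le_trans (hpsi _ _) _.
  apply: le_trans (Cr _ _) _; rewrite ler_piMr //; by have /andP[] := rX i.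
- apply: ler_norm_sum_geometric => // [|k _]; first exact: mulr_ge0.
  rewrite normrM mulrAC ler_pM //; last exact: hu.
  exact: le_trans (hpsi _ _) (Cr _ _).
- apply: ler_norm_sum_geometric => // [|l _]; first exact: mulr_ge0.
  rewrite normrM mulrAC ler_pM //; last exact: hu.
  exact: le_trans (hpsi _ _) (CrC _ _).
- apply: ler_norm_sum_geometric => // [|k ki].
    by rewrite !mulr_ge0 // invr_ge0 subr_ge0 ltW.
  rewrite mulrAC; have /andP[k0 _] := rX k.
  apply: ler_norm_sum_geometric => // [|l lj]; first by rewrite !mulr_ge0.
  rewrite normrM (_ : _ * r ^+ l = C * (r ^+ k * r ^+ l) * M); last by ring.
  by rewrite ler_pM // hv // subn_gt0.
Qed.

Theorem proposition8 (R : realType) (a b c : R)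
    (h1 : 0 < 1 - a - b - c) (h2 : 0 < 1 - a + b + c)
    (h3 : 0 < 1 + a - b + c) (h4 : 0 < 1 + a + b - c)
    (v x : nat -> nat -> R) :
  (recurrence a b c v x <->
     (forall i j : nat, (0 < i)%N -> (0 < j)%N ->
        x i j = explicit_value a b c v x i j)) /\
  (recurrence a b c v x ->
     [bounded x i 0%N | i in [set: nat]] ->
     [bounded x 0%N j | j in [set: nat]] ->
     [bounded v p.1 p.2 | p in [set p : nat * nat | (0 < p.1)%N /\ (0 < p.2)%N]] ->
     [bounded x p.1 p.2 | p in [set: nat * nat]]).
Proof.
split.
  split; last exact: explicit_recurrence.
  by move=> hx i j _ _; exact: recurrence_explicit.
move=> hx bx0 b0x bv.
have [C [r [C0 hr hpsi]]] := @psi_decay _ a b c h1 h2 h3 h4.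
have [M [hM0 h0M hMv]] : exists M, [/\ forall i, `|x i 0%N| <= M,
    forall j, `|x 0%N j| <= M &
    forall i j, (0 < i)%N -> (0 < j)%N -> `|v i j| <= M].
  have [[M1 [_ hM1]] [M2 [_ hM2]] [M3 [_ hM3]]] := And3 bx0 b0x bv.
  (* [[bounded _ | _ in _]] bounds the data by every number strictly above a threshold, hence the
     [+ 1]. *)
  pose M := `|M1| + `|M2| + `|M3| + 1.
  have n1 := normr_ge0 M1; have n2 := normr_ge0 M2; have n3 := normr_ge0 M3.
  have l1 := ler_norm M1; have l2 := ler_norm M2; have l3 := ler_norm M3.
  exists M; split=> [i|j|i j i0 j0].
  - by apply: (hM1 M) => //; rewrite /M; lra.
  - by apply: (hM2 M) => //; rewrite /M; lra.
  - by apply: (hM3 M _ (i, j)) => //; rewrite /M; lra.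
have [K hK] := @explicit_value_bounded _ a b c C r M v x C0 hr hpsi hM0 h0M hMv.
exists K; split; first exact: num_real.
move=> M' KM [i j] _ /=; rewrite (recurrence_explicit _ _ _ _ _ _ hx).
exact: le_trans (hK i j) (ltW KM).
Qed.
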